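(* For each $\lambda\in\mathbb R\setminus\{0\}$ let $$S_\lambda=\left\{(x,t)\in\mathbb R\times\mathbb R: x>0\ \text{ and }\ \left(0\le t\le\frac{x^\lambda-1}{\lambda}\ \text{ or }\ 0\ge t\ge\frac{x^\lambda-1}{\lambda}\right)\right\},$$ and let $\mathcal A=\{S_\lambda\}_{\lambda\in\mathbb R\setminus\{0\}}$. Then $\Delta_{\mathcal A}(n)\le n+1$ for every positive integer $n$.
   Context: For a collection $\mathcal A$ of subsets of $\mathbb R^2$ and a finite set $G\subset\mathbb R^2$, let $G\cap\mathcal A=\{G\cap A:A\in\mathcal A\}$, and $\Delta_{\mathcal A}(n)=\sup\{|G\cap\mathcal A|: G\subset\mathbb R^2,\ |G|=n\}$, where $|\cdot|$ denotes cardinality. *)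

(* Defs.v *)
From mathcomp Require Import all_boot all_order all_algebra.
From mathcomp Require Import all_classical all_reals all_analysis.

Set Implicit Arguments.
Unset Strict Implicit.
Unset Printing Implicit Defensive.

Import Order.TTheory GRing.Theory Num.Theory.

Local Open Scope classical_set_scope.
Local Open Scope ring_scope.

Definition trace_family (T : Type) (A : set (set T)) (G : set T) : set (set T) :=
  [set G `&` B | B in A].

(* counting is +oo on infinite sets, so the supremum, taken in \bar R, involves
   no default value for infinite cardinalities. *)
Definition growth_function (R : realType) (A : set (set (R * R))) (n : nat) :
    \bar R :=
  ereal_sup [set counting (trace_family A G) |
             G in [set G : set (R * R) | (G #= `I_n)%card]].

Definition boxcox_region (R : realType) (lambda : R) : set (R * R) :=
  [set p | let x := p.1 in let t := p.2 in
    0 < x /\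
    (0 <= t <= (x `^ lambda - 1) / lambda \/
     (x `^ lambda - 1) / lambda <= t <= 0)].

Definition boxcox_family (R : realType) : set (set (R * R)) :=
  [set boxcox_region lambda | lambda in [set lambda : R | lambda != 0]].

Arguments boxcox_family R : clear implicits.

(* Main.v *)
Require Import Defs.
From mathcomp Require Import all_boot all_order all_algebra.
From mathcomp Require Import all_classical all_reals all_analysis.
From mathcomp Require Import finmap lra.

(** For a fixed [x > 0] the Box-Cox transform [(x `^ lambda - 1) / lambda] is
    nondecreasing in [lambda], because it is the slope of the chord of the convex
    function [lambda |-> x `^ lambda] between the exponents [0] and [lambda]
    ([boxcox_nondecreasing]). So, as [lambda] grows, a point above the horizontal
    axis can enter the region but not leave it, a point below the axis can leave
    it but not come back, and a point on the axis is always inside or always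
    outside, according to the sign of its abscissa.

    Taking the symmetric difference of every region with the open lower
    half-plane reverses the behaviour of the points below the axis, and the
    family of regions becomes a chain for inclusion ([boxcox_region_flip_mono]).
    A symmetric difference with a fixed set is a bijection, hence it does not
    change the number of traces on a finite set [G] ([card_trace_le]); and a
    chain of subsets of an [n]-element set has at most [n + 1] members, since
    they are told apart by their cardinality, which is one of [0], ..., [n]
    ([card_chain_le]). *)

Import Order.TTheory GRing.Theory Num.Theory.

Local Open Scope classical_set_scope.
Local Open Scope ring_scope.

(** Convexity of the exponential on the segment from [0] to [u]: the graph at
    [s * u] lies below the chord. *)
Lemma expR_chord (R : realType) (s u : R) : 0 <= s <= 1 ->
  expR (s * u) - 1 <= s * (expR u - 1).
Proof.
case/andP => s0 s1.
have := convex_expR (Itv01 s0 s1) u 0.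
by rewrite !convRE /= mulr0 addr0 expR0 mulr1 /unstable.onem; lra.
Qed.

(** With [L = ln x], the two sides are the slopes of the chords of the convex
    function [c |-> expR (c * L)] from [0] to [a] and from [0] to [b]. When [a]
    and [b] have the same sign, the one closer to [0] is a convex combination of
    [0] and the other; when [a < 0 < b], the slope [L] of the tangent at [0]
    separates the two. *)
Lemma boxcox_nondecreasing (R : realType) (x a b : R) :
  0 < x -> a != 0 -> b != 0 -> a <= b ->
  (x `^ a - 1) / a <= (x `^ b - 1) / b.
Proof.
move=> x0 a0 b0 ab; rewrite /powR gt_eqF//.
set L := ln x.
have tangent (c : R) : c * L <= expR (c * L) - 1.
  by rewrite lerBrDl expR_ge1Dx.
case: (ltgtP a 0) a0 => [a_lt0 _|a_gt0 _|//].
- case: (ltgtP b 0) b0 => [b_lt0 _|b_gt0 _|//].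
  + have /(expR_chord _ _ (a * L)) : 0 <= b / a <= 1.
      apply/andP; split; first by rewrite mulr_le0 ?invr_le0 ?ltW.
      by rewrite ler_ndivrMr// mul1r.
    rewrite mulrA divfK ?lt_eqF// => h.
    by rewrite ler_ndivlMr// (le_trans h)// mulrAC -mulrA mulrC.
  + apply: (@le_trans _ _ L).
      by rewrite ler_ndivrMr// mulrC.
    by rewrite ler_pdivlMr// mulrC.
- have b_gt0 := lt_le_trans a_gt0 ab.
  have /(expR_chord _ _ (b * L)) : 0 <= a / b <= 1.
    apply/andP; split; first by rewrite divr_ge0 ?ltW.
    by rewrite ler_pdivrMr// mul1r.
  rewrite mulrA divfK ?gt_eqF// => h.
  by rewrite ler_pdivrMr// (le_trans h)// mulrAC -mulrA mulrC.
Qed.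

(** As the exponent grows, points with negative ordinate can only leave the
    region and the others can only enter it; flipping membership on the lower
    half-plane leaves only entries. *)
Lemma boxcox_region_flip_mono (R : realType) (a b : R) :
  a != 0 -> b != 0 -> a <= b ->
  boxcox_region a `+` [set p | p.2 < 0] `<=`
  boxcox_region b `+` [set p | p.2 < 0].
Proof.
move=> a0 b0 ab [x t] /=.
case=> [[[x0 gt] /negP]|[t0 notS]].
- rewrite -leNgt => t0; left; split; last by apply/negP; rewrite -leNgt.
  split=> //=; have gab := @boxcox_nondecreasing _ x a b x0 a0 b0 ab.
  case: gt => [/andP[_ tg]|/andP[_ t0']].
    by left; rewrite t0 (le_trans tg).
  (* The two conditions that define the region overlap on the axis, where the
     sign of the Box-Cox transform does not matter. *)
  have -> : t = 0 by apply/eqP; rewrite eq_le t0 t0'.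
  by rewrite lexx /= andbT; apply/orP; exact: le_total.
- right; split=> // -[/= x0 gt]; apply: notS; split=> //=; right.
  case: gt => [/andP[]|/andP[gt _]]; first by rewrite leNgt t0.
  by rewrite (ltW t0) andbT (le_trans _ gt)// boxcox_nondecreasing.
Qed.

Lemma card_le_inj_in (T U : Type) (A : set T) (B : set U) (f : T -> U) :
  {in A &, injective f} -> f @` A `<=` B -> (A #<= B)%card.
Proof.
move=> f_inj fAB; rewrite -(card_le_eql (inj_card_eq f_inj)).
exact: subset_card_le.
Qed.

(** Cardinality is injective on a chain of finite sets, and takes values in
    [{0, ..., n}] on subsets of an [n]-element set. *)
Lemma card_chain_le (T : choiceType) (G : set T) (n : nat)
    (C : set (set T)) : (G #= `I_n)%card ->
  (forall A, C A -> A `<=` G) ->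
  (forall A B, C A -> C B -> A `<=` B \/ B `<=` A) ->
  (C #<= `I_n.+1)%card.
Proof.
move=> Gn CG Cchain.
have finG : finite_set G by exists n.
have finC A : C A -> finite_set A by move=> /CG AG; exact: sub_finite_set AG finG.
apply: (@card_le_inj_in _ _ _ _ (fun A => #|` fset_set A|%fset)).
- have sub_eq A B : C A -> C B -> A `<=` B ->
      #|` fset_set A|%fset = #|` fset_set B|%fset -> A = B.
    move=> CA CB AB eqc; apply: fset_set_inj; [exact: finC..|].
    apply/eqP; rewrite eqEfcard eqc leqnn andbT.
    by rewrite -fset_set_sub //; exact: finC.
  move=> A B /set_mem CA /set_mem CB; case: (Cchain A B CA CB) => [AB|BA] eqc.
    exact: sub_eq.
  by apply/esym/sub_eq.
- move=> _ [A CA <-] /=; rewrite ltnS -(card_fset_set Gn).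
  by apply/fsubset_leq_card; rewrite -fset_set_sub//; [exact: CG|exact: finC].
Qed.

(** Flipping the membership of the points of a fixed set [N] is an involution
    and commutes with taking traces, so a family that becomes a chain after such
    a flip has as few traces as a chain. *)
Lemma card_trace_le (T : choiceType) (F : set (set T)) (N G : set T)
    (n : nat) : (G #= `I_n)%card ->
  (forall A B, F A -> F B ->
     A `+` N `<=` B `+` N \/ B `+` N `<=` A `+` N) ->
  (trace_family F G #<= `I_n.+1)%card.
Proof.
move=> Gn Fchain.
pose flip (H : set T) := H `+` (G `&` N).
have flipK : cancel flip flip by move=> H; rewrite /flip -setYA setYK setY0.
rewrite -(card_le_eql (inj_card_eq (in2W (can_inj flipK)))).
have flipI A : flip (G `&` A) = G `&` (A `+` N) by rewrite /flip -setIYr.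
apply: (card_chain_le _ _ _ _ Gn).
- by move=> _ [_ [A _ <-] <-]; rewrite flipI; exact: subIsetl.
- move=> _ _ [_ [A FA <-] <-] [_ [B FB <-] <-]; rewrite !flipI.
  by case: (Fchain A B FA FB) => h; [left|right]; exact: setIS.
Qed.

Theorem lemma1 (R : realType) (n : nat) (hn : (0 < n)%N) :
  (growth_function (boxcox_family R) n <= (n.+1)%:R%:E)%E.
Proof.
apply: ge_ereal_sup => _ [G /= Gn <-].
have tr : (trace_family (boxcox_family R) G #<= `I_n.+1)%card.
  apply: (card_trace_le _ _ [set p | p.2 < 0] _ _ Gn).
  move=> _ _ [a /= a0 <-] [b /= b0 <-].
  by case: (leP a b) => [ab|/ltW ba]; [left|right];
    exact: boxcox_region_flip_mono.
have fin := card_le_finite tr (finite_II _).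
rewrite /counting asboolT// lee_fin ler_nat.
exact: geq_card_fset_set.
Qed.
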